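(* Let $G$ be a strongly topological gyrogroup with a symmetric neighborhood base $\mathscr U$ at $0$ and let $H$ be a second-countable admissible subgyrogroup of $G$ generated from $\mathscr U$. If the quotient space $G/H$ has a star-countable $wcs^{*}$-network, then $G$ also has a star-countable $wcs^{*}$-network.
   Context: All topological spaces are assumed to be Hausdorff. A gyrogroup is a set $G$ with a binary operation $\oplus$ such that: (G1) there is a unique identity element $0\in G$ with $0\oplus a=a=a\oplus 0$ for all $a\in G$; (G2) for each $x\in G$ there is a unique inverse $\ominus x\in G$ with $\ominus x\oplus x=0=x\oplus(\ominus x)$; (G3) for all $x,y\in G$ there is an automorphism $\mathrm{gyr}[x,y]$ of $(G,\oplus)$ with $x\oplus(y\oplus z)=(x\oplus y)\oplus \mathrm{gyr}[x,y](z)$ for all $z\in G$; (G4) $\mathrm{gyr}[x\oplus y,y]=\mathrm{gyr}[x,y]$ for all $x,y\in G$. A topological gyrogroup is a gyrogroup with a topology such that $\oplus:G\times G\to G$ is jointly continuous and $x\mapsto\ominus x$ is continuous. A strongly topological gyrogroup with a symmetric neighborhood base $\mathscr U$ at $0$ is a topological gyrogroup $G$ together with a neighborhood base $\mathscr U$ of $0$ such that for every $U\in\mathscr U$: $\ominus U=U$ and $\mathrm{gyr}[x,y](U)=U$ for all $x,y\in G$. A subgyrogroup of $G$ is a nonempty subset $H$ with $\ominus a\in H$ and $a\oplus b\in H$ for all $a,b\in H$; it is an $L$-subgyrogroup if moreover $\mathrm{gyr}[a,h](H)=H$ for all $a\in G$, $h\in H$. A subgyrogroup $H$ of $G$ is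 an admissible subgyrogroup generated from $\mathscr U$ if there is a sequence $\{U_n:n\in\omega\}$ of open symmetric neighborhoods of $0$ with each $U_n\in\mathscr U$, $U_{n+1}\oplus(U_{n+1}\oplus U_{n+1})\subset U_n$ for each $n\in\omega$, and $H=\bigcap_{n\in\omega}U_n$. Such an $H$ is known to be a closed $L$-subgyrogroup of $G$. For an $L$-subgyrogroup $H$, the set $G/H=\{a\oplus H:a\in G\}$ is a partition of $G$; it carries the quotient topology with respect to $\pi:G\to G/H$, $\pi(a)=a\oplus H$ (i.e. $O\subset G/H$ is open iff $\pi^{-1}(O)$ is open in $G$). Subsets such as $H$ carry the subspace topology. A family $\mathcal P$ of subsets of a space $X$ is a $wcs^{*}$-network for $X$ if, given a sequence $\{x_n\}_n$ converging to a point $x$ in $X$ and a neighborhood $U$ of $x$ in $X$, there are a subsequence $\{x_{n_i}\}_i$ of $\{x_n\}_n$ and $P\in\mathcal P$ with $\{x_{n_i}:i\in\mathbb N\}\subset P\subset U$. A family $\mathcal P$ of sets is star-countable if each $P\in\mathcal P$ meets at most countably many members of $\mathcal P$. *)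

(* Defs.v *)
From HB Require Import structures.
From mathcomp Require Import all_boot all_order all_algebra.
From mathcomp Require Import all_classical all_reals all_analysis.

Set Implicit Arguments.
Unset Strict Implicit.
Unset Printing Implicit Defensive.

Local Open Scope classical_set_scope.
Local Open Scope quotient_scope.

Reserved Notation "x ⊕ y" (at level 50, left associativity).
Reserved Notation "⊖ x" (at level 35, right associativity, format "⊖ x").

(* [gyr] is data here, but it is determined by the gyroassociative law [gyroA]
   together with the existence of inverses. *)
HB.mixin Record isGyrogroup (G : Type) := {
  gzero : G;
  gadd : G -> G -> G;
  gopp : G -> G;
  gyr : G -> G -> G -> G;
  gzero_unique : unique (fun e => left_id e gadd /\ right_id e gadd) gzero;
  gopp_unique : forall x,
    unique (fun y => gadd y x = gzero /\ gadd x y = gzero) (gopp x);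
  gyr_bij : forall x y, bijective (gyr x y);
  gyrD : forall x y, {morph gyr x y : a b / gadd a b};
  gyroA : forall x y z, gadd x (gadd y z) = gadd (gadd x y) (gyr x y z);
  gyr_loop : forall x y, gyr (gadd x y) y = gyr x y
}.

#[short(type="gyrogroupType")]
HB.structure Definition Gyrogroup := {G of Choice G & isGyrogroup G}.

Declare Scope gyro_scope.
Delimit Scope gyro_scope with gyro.
Notation "x ⊕ y" := (gadd x y) : gyro_scope.
Notation "⊖ x" := (gopp x) : gyro_scope.
Local Open Scope gyro_scope.

HB.mixin Record isTopologicalGyrogroup G of Topological G & Gyrogroup G := {
  gadd_continuous : continuous (fun p : G * G => p.1 ⊕ p.2);
  gopp_continuous : continuous (gopp : G -> G)
}.

#[short(type="topGyrogroupType")]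
HB.structure Definition TopologicalGyrogroup :=
  {G of Topological G & Gyrogroup G & isTopologicalGyrogroup G}.

Definition set_gadd (G : gyrogroupType) (A B : set G) : set G :=
  [set a ⊕ b | a in A & b in B].

Definition lgyrocoset (G : gyrogroupType) (H : set G) (a : G) : set G :=
  [set a ⊕ h | h in H].

Definition gsymmetric (G : gyrogroupType) (A : set G) := [set ⊖ a | a in A] = A.

Definition subgyrogroup (G : gyrogroupType) (H : set G) :=
  [/\ H !=set0,
      forall a, H a -> H (⊖ a) &
      forall a b, H a -> H b -> H (a ⊕ b)].

Definition nbhs_base (X : topologicalType) (x : X) (B : set (set X)) :=
  B `<=` nbhs x /\ forall V, nbhs x V -> exists2 W, B W & W `<=` V.

Definition strongly_topological (G : topGyrogroupType) (U : set (set G)) :=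
  nbhs_base gzero U /\
  forall V, U V -> gsymmetric V /\ forall x y, gyr x y @` V = V.

Definition admissible_subgyrogroup (G : topGyrogroupType) (U : set (set G))
    (H : set G) :=
  subgyrogroup H /\
  exists V : nat -> set G,
    [/\ forall n, open_nbhs gzero (V n) /\ gsymmetric (V n),
        forall n, U (V n),
        forall n, set_gadd (V n.+1) (set_gadd (V n.+1) (V n.+1)) `<=` V n &
        H = \bigcap_n V n].

Section GyroQuotient.
Context {G : topGyrogroupType} (H : set G).

(* G/H: its points are the sets a ⊕ H, and its topology is the quotient topology
   of a |-> a ⊕ H. Nothing is required of H here; the sets a ⊕ H partition G
   when H is an L-subgyrogroup. *)
Definition gyro_quotient : Type := set_type (range (lgyrocoset H)).

Definition gyro_pi (a : G) : gyro_quotient :=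
  SigSub (mem_set (imageT (lgyrocoset H) a)).

Lemma gyro_pi_surj (C : gyro_quotient) : exists a, gyro_pi a = C.
Proof.
case: C => C CH; have /set_mem[a _ aHC] := CH.
by exists a; apply/val_inj.
Qed.

Definition gyro_repr (C : gyro_quotient) : G := projT1 (cid (gyro_pi_surj C)).

Lemma gyro_reprK : cancel gyro_repr gyro_pi.
Proof. by move=> C; rewrite /gyro_repr; case: cid. Qed.

HB.instance Definition _ := isQuotient.Build G gyro_quotient gyro_reprK.
HB.instance Definition _ :=
  Topological.copy gyro_quotient (quotient_topology gyro_quotient).

Lemma gyro_quotient_openE (O : set gyro_quotient) :
  open O = open (gyro_pi @^-1` O).
Proof.
suff <- : \pi_gyro_quotient = gyro_pi by [].
by apply/funext => a; rewrite unlock.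
Qed.

End GyroQuotient.

Definition wcs_star_network (X : topologicalType) (P : set (set X)) :=
  forall (u : nat -> X) (x : X) (U : set X), u @ \oo --> x -> nbhs x U ->
  exists phi : nat -> nat, {homo phi : m n / (m < n)%N} /\
  exists2 A, P A & range (u \o phi) `<=` A /\ A `<=` U.

Definition star_countable (X : Type) (P : set (set X)) :=
  forall A, P A -> countable [set B | P B /\ A `&` B !=set0].

Definition has_star_countable_wcs_star_network (X : topologicalType) :=
  exists P : set (set X), wcs_star_network P /\ star_countable P.

(* Main.v *)
(* Let W range over countably many members of the base U whose triple sums have
   traces on H forming a neighborhood base of 0 in H. If d is close to x and P
   is a subset of π(x ⊕ (V ∩ W)), then (d ⊕ W) ∩ π^-1(P) is contained in
   x ⊕ (V ⊕ V), so the topology of G is controlled by that of G/H together with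
   countably many sets W. Each member P of a star-countable wcs*-network is
   separable, hence so is π^-1(P), and it suffices to let d range over a
   countable set D_P that is dense at the points of π^-1(P). The sets
   (d ⊕ W) ∩ π^-1(P) form a wcs*-network, which is star-countable since two of
   them can only meet when the corresponding members P do. *)
Require Import Defs.
From mathcomp Require Import all_boot all_order all_algebra.
From mathcomp Require Import all_classical all_reals all_analysis.

Set Implicit Arguments.
Unset Strict Implicit.
Unset Printing Implicit Defensive.

Local Open Scope classical_set_scope.
Local Open Scope gyro_scope.

(** * Cancellation laws and sets invariant under gyrations *)

Lemma gadd0g (G : gyrogroupType) : left_id (@gzero G) gadd.
Proof. by have [[]] := @gzero_unique G. Qed.

Lemma gaddg0 (G : gyrogroupType) : right_id (@gzero G) gadd.
Proof. by have [[]] := @gzero_unique G. Qed.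

Lemma gaddNg (G : gyrogroupType) (x : G) : ⊖ x ⊕ x = gzero.
Proof. by have [[]] := gopp_unique x. Qed.

Lemma gaddgN (G : gyrogroupType) (x : G) : x ⊕ ⊖ x = gzero.
Proof. by have [[]] := gopp_unique x. Qed.

Lemma goppK (G : gyrogroupType) : involutive (@gopp G).
Proof.
move=> x; have [_] := gopp_unique (⊖ x); apply.
by rewrite gaddNg gaddgN.
Qed.

Lemma gaddI (G : gyrogroupType) (x : G) : injective (gadd x).
Proof.
move=> u v /(congr1 (gadd (⊖ x))); rewrite !gyroA gaddNg !gadd0g.
by move/(bij_inj (gyr_bij _ _)).
Qed.

Lemma gyr0g (G : gyrogroupType) (x z : G) : gyr gzero x z = z.
Proof. by apply: (@gaddI _ x); have := gyroA gzero x z; rewrite !gadd0g. Qed.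

(** The loop property turns [gyr (⊖ x) x] into [gyr gzero x], which is the identity. *)
Lemma gaddKg (G : gyrogroupType) (x z : G) : ⊖ x ⊕ (x ⊕ z) = z.
Proof. by rewrite gyroA gaddNg gadd0g -gyr_loop gaddNg gyr0g. Qed.

Lemma gaddNKg (G : gyrogroupType) (x z : G) : x ⊕ (⊖ x ⊕ z) = z.
Proof. by have := gaddKg (⊖ x) z; rewrite goppK. Qed.

Definition gyr_invariant (G : gyrogroupType) (A : set G) :=
  forall x y, gyr x y @` A = A.

Lemma gyr_invariantP (G : gyrogroupType) (A : set G) (x y z : G) :
  gyr_invariant A -> A z -> A (gyr x y z).
Proof. by move=> invA Az; rewrite -(invA x y); exists z. Qed.

(** Stands in for associativity: the gyration is absorbed by passing from [z] to a preimage under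
    [gyr x y], which can be taken in [A]. *)
Lemma gaddA_invariant (G : gyrogroupType) (A : set G) (x y z : G) :
  gyr_invariant A -> A z -> exists2 z', A z' & (x ⊕ y) ⊕ z = x ⊕ (y ⊕ z').
Proof.
move=> invA; rewrite -{1}(invA x y) => -[z' Az' <-].
by exists z' => //; rewrite gyroA.
Qed.

(** Injectivity of the gyration makes the single preimage [g z] serve for all [i] at once. *)
Lemma gyr_invariant_bigcap (G : gyrogroupType) (T : Type) (V : T -> set G) :
  (forall i, gyr_invariant (V i)) -> gyr_invariant (\bigcap_i V i).
Proof.
move=> invV x y; apply/seteqP; split=> [_ [z Vz <-] i _|z Vz].
  by apply: (gyr_invariantP _ _ (invV i)); exact: Vz.
have [g gyrK gK] := gyr_bij x y; exists (g z) => // i _.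
by have := Vz i Logic.I; rewrite -{1}(invV i x y) => -[w Vw <-]; rewrite gyrK.
Qed.

(** * Cosets, the quotient map and translations *)

Lemma subgyrogroup0 (G : gyrogroupType) (H : set G) :
  subgyrogroup H -> H gzero.
Proof.
by move=> [[h Hh] HN HD]; rewrite -(gaddNg h); apply/HD => //; exact: HN.
Qed.

Lemma gyro_pi_gaddr (G : topGyrogroupType) (H : set G) (x h : G) :
  subgyrogroup H -> gyr_invariant H -> H h ->
  gyro_pi H (x ⊕ h) = gyro_pi H x.
Proof.
move=> [_ HN HD] invH Hh; apply: val_inj; apply/seteqP; split=> [_ [k Hk <-]|].
  have [k' Hk' ->] := gaddA_invariant x h invH Hk.
  by exists (h ⊕ k') => //; exact: HD.
move=> _ [k Hk <-]; rewrite -(gaddNKg h k) gyroA.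
exists (gyr x h (⊖ h ⊕ k)) => //.
by apply: (gyr_invariantP _ _ invH); apply: HD => //; exact: HN.
Qed.

Lemma gyro_pi_eq (G : topGyrogroupType) (H : set G) (x y : G) :
  subgyrogroup H -> gyro_pi H x = gyro_pi H y -> exists2 h, H h & x = y ⊕ h.
Proof.
move=> /subgyrogroup0 H0 /(congr1 val) /= xyH.
have : lgyrocoset H y x by rewrite -xyH; exists gzero; rewrite ?gaddg0.
by case=> h Hh <-; exists h.
Qed.

Lemma gyro_pi_continuous (G : topGyrogroupType) (H : set G) :
  continuous (gyro_pi H).
Proof. by apply/continuousP => O; rewrite gyro_quotient_openE. Qed.

Lemma gaddl_continuous (G : topGyrogroupType) (x : G) : continuous (gadd x).
Proof.
move=> y; apply: (@continuous2_cvg _ _ _ _ _ _ (fun=> x) id (@gadd G)).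
- exact: (@gadd_continuous G (x, y)).
- exact: cvg_cst.
- exact: cvg_id.
Qed.

Lemma gaddr_continuous (G : topGyrogroupType) (y : G) :
  continuous (fun x => x ⊕ y).
Proof.
move=> x; apply: (@continuous2_cvg _ _ _ _ _ _ id (fun=> y) (@gadd G)).
- exact: (@gadd_continuous G (x, y)).
- exact: cvg_id.
- exact: cvg_cst.
Qed.

(** The saturation of [O] is the union of its preimages under right translations by elements of [H],
    and these translations are continuous. *)
Lemma gyro_pi_open (G : topGyrogroupType) (H O : set G) :
  subgyrogroup H -> gyr_invariant H -> open O -> open (gyro_pi H @` O).
Proof.
move=> sgH invH oO; rewrite gyro_quotient_openE.
suff -> : gyro_pi H @^-1` (gyro_pi H @` O) =
    \bigcup_(h in H) ((fun x => x ⊕ h) @^-1` O).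
  apply: bigcup_open => h _.
  by move/continuousP: (@gaddr_continuous G h); exact.
apply/seteqP; split=> [x [y Oy +]|x [h Hh Oxh]].
  by move=> /(gyro_pi_eq sgH)[h Hh yE]; exists h => //=; rewrite -yE.
by exists (x ⊕ h) => //; exact: gyro_pi_gaddr.
Qed.

Lemma nbhs_gyro_pi (G : topGyrogroupType) (H : set G) (x : G) (V : set G) :
  subgyrogroup H -> gyr_invariant H -> nbhs x V ->
  nbhs (gyro_pi H x) (gyro_pi H @` V).
Proof.
move=> sgH invH; rewrite nbhsE => -[W [opW Wx] WV].
apply: (@filterS _ _ _ (gyro_pi H @` W)); first exact: image_subset.
by apply: open_nbhs_nbhs; split; [exact: gyro_pi_open|exists x].
Qed.

Lemma nbhs_gadd (G : topGyrogroupType) (x : G) (V : set G) :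
  nbhs x V <-> nbhs gzero (gadd x @^-1` V).
Proof.
split=> xV; first by apply: (@gaddl_continuous G x); rewrite gaddg0.
have := @gaddl_continuous G (⊖ x) x; rewrite /continuous_at gaddNg.
move=> /(_ _ xV) /=.
by congr (nbhs x _); apply/funext => y /=; rewrite gaddNKg.
Qed.

Lemma nbhs_gadd_image (G : topGyrogroupType) (x : G) (V : set G) :
  nbhs gzero V -> nbhs x (gadd x @` V).
Proof.
by move=> V0; apply/nbhs_gadd; apply: filterS V0 => v Vv; exists v.
Qed.

Lemma set_gaddP (G : gyrogroupType) (A B : set G) (a b : G) :
  A a -> B b -> set_gadd A B (a ⊕ b).
Proof. by move=> Aa Bb; exists a => //; exists b. Qed.

Lemma nbhs_base_set_gadd (G : topGyrogroupType) (U : set (set G)) (V : set G) :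
  nbhs_base gzero U -> nbhs gzero V ->
  exists2 W, U W & set_gadd W W `<=` V.
Proof.
move=> [Unbhs Ubase] V0.
have : nbhs (gzero, gzero) [set p : G * G | V (p.1 ⊕ p.2)].
  by apply: (@gadd_continuous G (gzero, gzero)) => /=; rewrite gadd0g.
case=> -[A B] /= [A0 B0] ABV.
have [W UW WAB] := Ubase _ (filterI A0 B0).
exists W => // _ [a /WAB[Aa _] [b /WAB[_ Bb] <-]].
exact: (ABV (a, b)).
Qed.

Lemma nbhs_base_set_gadd3 (G : topGyrogroupType) (U : set (set G)) (V : set G) :
  nbhs_base gzero U -> nbhs gzero V ->
  exists2 W, U W & set_gadd W (set_gadd W W) `<=` V.
Proof.
move=> Ub /(nbhs_base_set_gadd Ub)[W UW WV].
have [W' UW' W'W] := nbhs_base_set_gadd Ub (Ub.1 _ UW).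
exists W' => // _ [a W'a [b W'b <-]].
have W'0 : W' gzero by exact: nbhs_singleton (Ub.1 _ UW').
apply: WV; apply: set_gaddP; last exact: W'W.
by apply: W'W; rewrite -(gaddg0 a); exact: set_gaddP.
Qed.

(** * Countable families obtained from the hypotheses on [H] and [G/H] *)

Lemma countable_image (T S : Type) (f : T -> S) (A : set T) :
  countable A -> countable (f @` A).
Proof. by apply: sub_countable; exact: card_image_le. Qed.

(** One open set of [X] is chosen for each member of the countable base of [H], so that later
    arguments stay in the ambient space. *)
Lemma second_countable_subspace (X : topologicalType) (H : set X) :
  @second_countable (set_type H) ->
  exists2 B : set (set X), countable B &
    B `<=` open /\
    forall h V, H h -> nbhs h V -> exists2 O, B O & O h /\ O `&` H `<=` V.
Proof.
move=> [C cC [opC baseC]].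
have /choice[f fP] : forall A, exists V : set X,
    C A -> open V /\ set_val @^-1` V = A.
  move=> A; have [/opC[W opW WE]|nCA] := pselect (C A).
    by exists W.
  by exists set0.
exists (f @` C); first exact: countable_image.
split=> [_ [A /fP[opA _] <-] //|h V Hh hV].
have := @initial_continuous _ _ (set_val : set_type H -> X)
  (exist _ h (mem_set Hh)).
move=> /(_ _ hV) /baseC[A /= [CA Ah] AV].
have [_ fAE] := fP _ CA.
exists (f A); first by exists A.
split=> [|x [fAx Hx]]; first by move: Ah; rewrite -{1}fAE.
by apply: (AV (exist _ x (mem_set Hx))); rewrite -fAE.
Qed.

Lemma admissible_gyr_invariant (G : topGyrogroupType) (U : set (set G))
    (H : set G) :
  strongly_topological U -> admissible_subgyrogroup U H -> gyr_invariant H.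
Proof.
move=> [_ Uinv] [_ [V [_ UV _ ->]]].
by apply: gyr_invariant_bigcap => n; exact: (Uinv _ (UV n)).2.
Qed.

(** One member of [U] is chosen for each basic open set around 0. Triple sums are needed to control
    elements of the form [⊖ v ⊕ (e ⊕ w')]. *)
Lemma countable_neighborhoods (G : topGyrogroupType) (H : set G)
    (U : set (set G)) :
  subgyrogroup H -> @second_countable (set_type H) ->
  nbhs_base gzero U ->
  exists2 W : set (set G), countable W &
    W `<=` U /\ forall V, nbhs gzero V ->
      exists2 A, W A & set_gadd A (set_gadd A A) `&` H `<=` V.
Proof.
move=> sgH scH Ub; have [B cB [opB baseB]] := second_countable_subspace scH.
have /choice[f fP] : forall O, exists W, B O /\ O gzero ->
    U W /\ set_gadd W (set_gadd W W) `<=` O.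
  move=> O; have [[BO O0]|] := pselect (B O /\ O gzero).
    have O_ : nbhs gzero O by apply: open_nbhs_nbhs; split=> //; exact: opB.
    by have [W UW WO] := nbhs_base_set_gadd3 Ub O_; exists W.
  by exists set0.
exists (f @` [set O | B O /\ O gzero]).
  apply: countable_image; apply: sub_countable cB.
  by apply: subset_card_le => W [].
split=> [_ [W /fP[UW _] <-] //|V /(baseB _ _ (subgyrogroup0 sgH))[W BW [W0 WV]]].
exists (f W); first by exists W.
have [_ fW] := fP _ (conj BW W0).
by move=> x [/fW Wx Hx]; apply: WV.
Qed.

Lemma countable_dense (G : topGyrogroupType) (H : set G) :
  @second_countable (set_type H) ->
  exists2 E : set G, countable E &
    forall h V, H h -> nbhs h V -> exists2 e, E e & V e.
Proof.
move=> scH; have [B cB [_ baseB]] := second_countable_subspace scH.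
(* The default [gzero] serves only when the trace is empty. *)
exists ((fun O => xget gzero (O `&` H)) @` B); first exact: countable_image.
move=> h V Hh /(baseB _ _ Hh)[W BW [Wh WV]].
exists (xget gzero (W `&` H)); first by exists W.
by apply: WV; apply: xgetPex; exists h.
Qed.

(* The members of the network that meet [P] give a countable network of [P],
   so [P] is separable, and so is its preimage, as [gyro_pi H] is open and its
   fibres are translates of [H]. *)
Lemma preimage_separable (G : topGyrogroupType) (H : set G)
    (N : set (set (gyro_quotient H)))
    (P : set (gyro_quotient H)) :
  subgyrogroup H -> gyr_invariant H -> @second_countable (set_type H) ->
  wcs_star_network N -> star_countable N -> N P ->
  exists2 D : set G, countable D &
    forall z V, P (gyro_pi H z) -> nbhs z V -> exists2 d, D d & V d.
Proof.
move=> sgH invH scH netN scN NP; have [E cE dE] := countable_dense scH.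
pose S := [set Q | N Q /\ P `&` Q !=set0].
pose b Q := xget gzero (gyro_pi H @^-1` Q).
exists (\bigcup_(Q in S) (gadd (b Q) @` E)).
  by apply: bigcup_countable => [|Q _]; [exact: scN|exact: countable_image].
move=> z V Pz zV.
(* With the interior, [V] is also a neighborhood of the point [y] found below. *)
have piV := nbhs_gyro_pi sgH invH (nbhs_interior zV).
(* Constant sequences show that [N] is a network in the ordinary sense. *)
have [phi [_ [Q NQ [zQ QV]]]] := netN (fun=> gyro_pi H z) _ _ (cvg_cst _) piV.
have {}zQ : Q (gyro_pi H z) by apply: zQ; exists 0%N.
have : Q (gyro_pi H (b Q)).
  by apply: (@xgetPex _ gzero (gyro_pi H @^-1` Q)); exists z.
move=> /QV[y Vy /(gyro_pi_eq sgH)[h Hh yE]].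
have : nbhs h (gadd (b Q) @^-1` V).
  by apply: (@gaddl_continuous G (b Q)); rewrite -yE.
move=> /(dE _ _ Hh)[e Ee Ve]; exists (b Q ⊕ e) => //.
by exists Q; [split=> //; exists (gyro_pi H z)|exists e].
Qed.

(* The topology of [G] at [x] is recovered from that of [G/H] at [gyro_pi H x]
   and the trace of [W] on [H]: if [x ⊕ (e ⊕ w') = x ⊕ (v ⊕ h')] then
   [h' = ⊖ v ⊕ (e ⊕ w')]. *)
Lemma translate_preimage_subset (G : topGyrogroupType) (H : set G)
    (V W : set G) (x e : G) :
  subgyrogroup H -> gyr_invariant H -> gsymmetric W -> gyr_invariant W -> W e ->
  set_gadd W (set_gadd W W) `&` H `<=` V ->
  (gadd (x ⊕ e) @` W) `&`
    gyro_pi H @^-1` (gyro_pi H @` (gadd x @` (V `&` W))) `<=`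
  gadd x @` set_gadd V V.
Proof.
move=> sgH invH symW invW We WV y [[w Ww wE] [_ [v [Vv Wv] <-]]].
move=> /esym/(gyro_pi_eq sgH)[h Hh yE].
have [w' Ww' xew] := gaddA_invariant x e invW Ww.
have [h' Hh' xvh] := gaddA_invariant x v invH Hh.
have h'E : h' = ⊖ v ⊕ (e ⊕ w').
  rewrite -(gaddKg v h'); congr (_ ⊕ _); apply: (@gaddI _ x).
  by rewrite -xvh -yE -xew wE.
exists (v ⊕ h'); last by rewrite -xvh -yE.
apply: set_gaddP => //; apply: WV; split=> //.
rewrite h'E; apply: set_gaddP; last exact: set_gaddP.
by rewrite -symW; exists v.
Qed.

(** Left cancellation gives [x ⊕ w = (x ⊕ e) ⊕ gyr x e (⊖ e ⊕ w)]. This moves terms close to [x]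
    into a translate based at a nearby dense point. *)
Lemma mem_near_translate (G : gyrogroupType) (W W' : set G) (x e w : G) :
  gsymmetric W -> gyr_invariant W' -> set_gadd W W `<=` W' -> W e -> W w ->
  (gadd (x ⊕ e) @` W') (x ⊕ w).
Proof.
move=> symW invW' WW' We Ww; rewrite -(gaddNKg e w) gyroA.
exists (gyr x e (⊖ e ⊕ w)) => //; apply: gyr_invariantP => //; apply: WW'.
by apply: set_gaddP => //; rewrite -symW; exists e.
Qed.

Theorem theorem3p9 (G : topGyrogroupType) (U : set (set G)) (H : set G)
    (hausG : hausdorff_space G)
    (strongU : strongly_topological U)
    (admH : admissible_subgyrogroup U H)
    (scH : @second_countable (set_type H))
    (netGH : has_star_countable_wcs_star_network (gyro_quotient H)) :
  has_star_countable_wcs_star_network G.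
Proof.
have invH := admissible_gyr_invariant strongU admH.
have [sgH _] := admH; have [Ub Uinv] := strongU.
have [N [netN scN]] := netGH.
have [B cB [BU baseB]] := countable_neighborhoods sgH scH Ub.
have /choice[D DP] : forall P, exists D : set G, N P ->
    countable D /\ forall z V, P (gyro_pi H z) -> nbhs z V ->
      exists2 d, D d & V d.
  move=> P; have [NP|] := pselect (N P); last by exists set0.
  by have [D cD dD] := preimage_separable sgH invH scH netN scN NP; exists D.
pose F P d W := (gadd d @` W) `&` gyro_pi H @^-1` P.
exists [set A | exists2 P, N P & exists2 d, D P d & exists2 W, B W & A = F P d W].
split=> [u x O ux xO|A [P NP [d _ [W _ ->]]]]; last first.
  pose S := [set Q | N Q /\ P `&` Q !=set0].
  apply: (@sub_countable _ _ _
    (\bigcup_(Q in S) \bigcup_(d' in D Q) (F Q d' @` B))).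
    apply: subset_card_le => _ [[Q NQ [d' Dd' [W' BW' ->]]]].
    move=> [y [[_ Py] [_ Qy]]].
    by exists Q; [split=> //; exists (gyro_pi H y)|exists d' => //; exists W'].
  apply: bigcup_countable => [|Q [NQ _]]; first exact: scN.
  apply: bigcup_countable => [|d' _]; first exact: (DP _ NQ).1.
  exact: countable_image.
have [V1 UV1 V1O] : exists2 V, U V & set_gadd V V `<=` gadd x @^-1` O.
  apply: nbhs_base_set_gadd Ub _.
  by apply/(nbhs_gadd x O).
have V10 := Ub.1 _ UV1.
have [W BW WV1] := baseB _ V10.
have [symW invW] := Uinv _ (BU _ BW).
have W0 := Ub.1 _ (BU _ BW).
(* The dense point [x ⊕ e] and the terms of the sequence will all be taken in [x ⊕ T], which puts
   these terms in [(x ⊕ e) ⊕ W]. *)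
have [T UT TW] := nbhs_base_set_gadd Ub W0.
have [symT _] := Uinv _ UT; have T0 := Ub.1 _ UT.
have TsubW : T `<=` W.
  move=> t Tt; rewrite -(gaddg0 t); apply/TW/set_gaddP => //.
  exact: nbhs_singleton.
have piN : nbhs (gyro_pi H x)
    (gyro_pi H @` (gadd x @` (V1 `&` W))).
  exact/(nbhs_gyro_pi sgH invH)/nbhs_gadd_image/filterI.
(* The network may select any subsequence, so the sequence is first shifted to start inside
   [x ⊕ T]. *)
have [k uk] : exists k, forall n, (gadd x @` T)° (u (n + k)%N).
  have [k _ uk] := ux _ (nbhs_interior (nbhs_gadd_image x T0)).
  by exists k => n; apply: uk; rewrite /= leq_addl.
have pi_ux : gyro_pi H (u (n + k)%N) @[n --> \oo] --> gyro_pi H x.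
  apply: continuous_cvg; first exact: gyro_pi_continuous.
  exact: (cvg_comp (fun n => (n + k)%N) u (cvg_addnr k) ux).
have [phi [phi_lt [P NP [phiP PN]]]] :=
  netN (fun n => gyro_pi H (u (n + k)%N)) _ _ pi_ux piN.
(* [P] contains the selected terms but perhaps not [gyro_pi H x], and [D P] is known to be dense
   only at points over [P], so a term of the sequence replaces [x]. *)
have [z [Tz Pz]] : exists z, (gadd x @` T)° z /\ P (gyro_pi H z).
  exists (u (phi 0%N + k)%N); split; last by apply: phiP; exists 0%N.
  exact: uk.
have /DP[_ dD] := NP.
have [d Dd [e Te dE]] := dD _ _ Pz Tz; subst d.
exists (fun n => (phi n + k)%N); split.
  by move=> m n mn /=; rewrite ltn_add2r; exact: phi_lt.
exists (F P (x ⊕ e) W).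
  by exists P => //; exists (x ⊕ e) => //; exists W.
split=> [_ [n _ <-]|y [We Py]].
  split; last by apply: phiP; exists n.
  have [w Tw /= <-] := interior_subset (uk (phi n)).
  exact: mem_near_translate Te Tw.
have [v VVv <-] := translate_preimage_subset sgH invH symW invW (TsubW _ Te) WV1
  (conj We (PN _ Py)).
exact: V1O.
Qed.
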